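(* For positive integers $n$ and non-negative integers $T,E$, let $G_n[T,E]$ denote the number of sequences $(s_1,\dots,s_n)$ of non-negative integers such that $s_1\le s_2\le\cdots\le s_n$, $\sum_{i=1}^r s_i>\binom{r}{2}$ for all $1\le r<n$, $s_n=E$, and $\sum_{i=1}^n s_i=T$. Let $SSCS(n)$ denote the number of score sequences of length $n$ that are both strong and self-complementary. Then for all $m\ge1$, $$SSCS(2m)=\sum_{T=\binom m2+1}^{m(m-1)}\ \sum_{E=\lceil T/m\rceil}^{m-1} G_m[T,E],$$ and $$SSCS(2m+1)=\sum_{T=\binom m2+1}^{m^2}\ \sum_{E=\lceil T/m\rceil}^{m} G_m[T,E],$$ where empty sums are $0$.
   Context: A score sequence of length $n\ge1$ is a sequence $(s_1,\dots,s_n)$ of non-negative integers with $s_1\le\cdots\le s_n$, $\sum_{i=1}^r s_i\ge\binom r2$ for $1\le r<n$ and $\sum_{i=1}^n s_i=\binom n2$ (equivalently, the nondecreasing out-degree sequence of a tournament on $n$ vertices). It is strong if $\sum_{i=1}^r s_i>\binom r2$ for all $1\le r<n$, and self-complementary if $s_{n+1-i}=n-1-s_i$ for all $1\le i\le\lfloor n/2\rfloor$. *)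

(* Defs.v *)
From mathcomp Require Import all_boot all_order all_algebra.

Set Implicit Arguments.
Unset Strict Implicit.
Unset Printing Implicit Defensive.

(* Sequences are 0-indexed here: s_(i+1) is [nth 0 s i]. *)

Definition psum (s : seq nat) (r : nat) : nat := \sum_(i < r) nth 0 s i.

Definition is_score_seq (n : nat) (s : seq nat) : bool :=
  [&& size s == n, sorted leq s,
      [forall r : 'I_n, (0 < r) ==> ('C(r, 2) <= psum s r)]
    & psum s n == 'C(n, 2)].

Definition strong (n : nat) (s : seq nat) : bool :=
  [forall r : 'I_n, (0 < r) ==> ('C(r, 2) < psum s r)].

(* s_(n+1-i) = n-1-s_i for 1 <= i <= n/2, with i = j+1; s_i is moved to the
   left-hand side because subtraction on nat truncates. *)
Definition self_complementary (n : nat) (s : seq nat) : bool :=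
  [forall j : 'I_n./2, nth 0 s (n.-1 - j) + nth 0 s j == n.-1].

Definition is_SSCS (n : nat) (s : seq nat) : bool :=
  [&& is_score_seq n s, strong n s & self_complementary n s].

Definition is_G (n T E : nat) (s : seq nat) : bool :=
  [&& size s == n, sorted leq s, strong n s, nth 0 s n.-1 == E
    & psum s n == T].

(* The number of s of length n with entries at most b satisfying P. It is only
   used when P forces the entries to sum to b, so that the bound excludes
   nothing: see SSCS_size and G_size. *)
Definition nb_seqs (n b : nat) (P : pred (seq nat)) : nat :=
  #|[set t : n.-tuple 'I_b.+1 | P (map val t)]|.

Definition SSCS (n : nat) : nat := nb_seqs n 'C(n, 2) (is_SSCS n).

Definition G (n T E : nat) : nat := nb_seqs n T (is_G n T E).

(* The ceiling is non-negative, so the absolute value only casts it to nat. *)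
Definition ceil_div (T m : nat) : nat :=
  `|Num.ceil (T%:Q / m%:Q)%R|%N.

Lemma psum_ge (s : seq nat) (n x : nat) :
  size s = n -> x \in s -> x <= psum s n.
Proof.
move=> sz xs; rewrite /psum -sz.
have ix : index x s < size s by rewrite index_mem.
by rewrite (bigD1 (Ordinal ix)) //= nth_index // leq_addr.
Qed.

Lemma nb_seqs_size (n b : nat) (P : pred (seq nat)) (l : seq (seq nat)) :
  (forall s, P s -> size s = n /\ psum s n = b) ->
  uniq l -> l =i P -> nb_seqs n b P = size l.
Proof.
move=> HP ul lP; rewrite /nb_seqs cardE.
set A := enum _.
have inj : injective (fun t : n.-tuple 'I_b.+1 => map val t).
  by move=> t u /(inj_map val_inj) /val_inj.
rewrite -(size_map (fun t : n.-tuple 'I_b.+1 => map val t)).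
apply/perm_size/uniq_perm => //; first by rewrite map_inj_uniq // enum_uniq.
move=> s; rewrite lP; apply/mapP/idP => [[t + ->]|Ps].
  by rewrite mem_enum inE.
have [sz sb] := HP s Ps.
have szt : size (map (@inord b) s) == n by rewrite size_map sz.
have E : s = map val (Tuple szt).
  rewrite /= -map_comp -[LHS]map_id; apply/eq_in_map => x xs /=.
  by rewrite inordK // ltnS -sb psum_ge.
by exists (Tuple szt) => //; rewrite mem_enum inE -E.
Qed.

Lemma SSCS_size (n : nat) (l : seq (seq nat)) :
  uniq l -> l =i is_SSCS n -> SSCS n = size l.
Proof.
by apply: nb_seqs_size => s /and3P[/and4P[/eqP-> _ _ /eqP->] _ _].
Qed.

Lemma G_size (n T E : nat) (l : seq (seq nat)) :
  uniq l -> l =i is_G n T E -> G n T E = size l.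
Proof. by apply: nb_seqs_size => s /and5P[/eqP-> _ _ _ /eqP->]. Qed.

(* Main.v *)
(** A self-complementary score sequence is determined by its first half, since
    [s_i + s_(n+1-i) = n-1] also holds in the middle by the sum condition.  The
    partial sums [S_r] then satisfy [S_(n-k) + k(n-1) = S_n + S_k], and
    [binom(n-k,2) + k(n-1) = binom(n,2) + binom(k,2)], so strength need only be
    checked in the first half.  The first halves are sorted according to their
    sum [T] and their last entry [E]; monotonicity across the middle is
    [2E <= n-1], and monotonicity of the half forces [T <= (n/2)E]. *)
Require Import Defs.
From mathcomp Require Import all_boot all_order all_algebra.
From mathcomp Require Import zify.

Set Implicit Arguments.
Unset Strict Implicit.
Unset Printing Implicit Defensive.

(** * Ceilings and partial sums *)

Lemma ceil_div_le (T m E : nat) : 0 < m -> (ceil_div T m <= E) = (T <= m * E).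
Proof.
move=> m_gt0; rewrite /ceil_div.
have ceil_ge0 : (0 <= Num.ceil (T%:Q / m%:Q))%R.
  by rewrite Num.Theory.ceil_ge0 (@Order.POrderTheory.lt_le_trans _ _ 0%R)
    // Num.Theory.divr_ge0 // Num.Theory.ler0n.
rewrite -lez_nat gez0_abs // Num.Theory.ceil_le_int.
rewrite Num.Theory.ler_pdivrMr ?Num.Theory.ltr0n //.
by rewrite -intrM ler_int -PoszM lez_nat mulnC.
Qed.

Lemma bin2_mul2 (n : nat) : 'C(n, 2) * 2 = n * n.-1.
Proof. by rewrite (bin_ffact n 2) ffactnS ffactn1. Qed.

Lemma psumS (s : seq nat) (r : nat) : psum s r.+1 = psum s r + nth 0 s r.
Proof. by rewrite /psum big_ord_recr. Qed.

Lemma eq_psum (s t : seq nat) (r : nat) :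
  (forall i, i < r -> nth 0 s i = nth 0 t i) -> psum s r = psum t r.
Proof. by move=> st; apply: eq_bigr => i _; apply: st. Qed.

Lemma psum_le_last (s : seq nat) (m : nat) :
  size s = m -> sorted leq s -> psum s m <= m * nth 0 s m.-1.
Proof.
move=> sz srt; rewrite -[X in X * _]card_ord -sum_nat_const.
apply: leq_sum => i _.
by apply: (sorted_leq_nth leq_trans leqnn) => //;
  rewrite ?inE; have := ltn_ord i; lia.
Qed.

(** * Complementary pairs and strength *)

(** Induction on [k]: the entry dropped from the long prefix is the partner of the one added to the
    short prefix. Pairs are assumed only below [k], so the identity is available before the middle
    entry is known. *)
Lemma psum_compl (n : nat) (s : seq nat) (k : nat) :
  k <= n ->
  (forall i, i < k -> nth 0 s (n.-1 - i) + nth 0 s i = n.-1) ->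
  psum s (n - k) + k * n.-1 = psum s n + psum s k.
Proof.
elim: k => [|k IHk] kn compl; first by rewrite subn0 /psum big_ord0; lia.
have := IHk (ltnW kn) (fun i ik => compl i (ltnW ik)).
have -> : n - k = (n.-1 - k).+1 by lia.
rewrite !psumS; have := compl k (ltnSn k).
have -> : n - k.+1 = n.-1 - k by lia.
lia.
Qed.

Lemma sccP (n : nat) (s : seq nat) :
  reflect (forall i, i < n./2 -> nth 0 s (n.-1 - i) + nth 0 s i = n.-1)
          (self_complementary n s).
Proof.
apply: (iffP forallP) => [H i im|H i]; last by apply/eqP/H.
by apply/eqP/(H (Ordinal im)).
Qed.

Lemma strongP (n : nat) (s : seq nat) :
  reflect (forall r, 0 < r -> r < n -> 'C(r, 2) < psum s r) (strong n s).
Proof.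
apply: (iffP forallP) => [H r r0 rn|H r]; last by apply/implyP => r0; apply: H.
by have /implyP := H (Ordinal rn); apply.
Qed.

Lemma compl_all (n : nat) (s : seq nat) :
  psum s n = 'C(n, 2) -> self_complementary n s ->
  forall i, i < n -> nth 0 s (n.-1 - i) + nth 0 s i = n.-1.
Proof.
move=> total /sccP scc i ilt.
have [/scc //|im] := ltnP i n./2.
have [jm|jm] := ltnP (n.-1 - i) n./2.
  by have := scc _ jm; rewrite subKn; lia.
have n_odd : n = (i.*2).+1 by lia.
have im' : n./2 = i by lia.
have -> : n.-1 - i = i by lia.
(* With [n = 2i+1], cancelling the [i] known pairs leaves [s_i = binom(n,2) - i(n-1) = i]. *)
have := @psum_compl n s i (ltnW ilt); rewrite -{1}im' => /(_ scc).
have -> : n - i = i.+1 by lia.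
rewrite psumS total; have := bin2_mul2 n; rewrite n_odd /=; nia.
Qed.

Lemma psum_total (n : nat) (s : seq nat) :
  (forall i, i < n -> nth 0 s (n.-1 - i) + nth 0 s i = n.-1) ->
  psum s n = 'C(n, 2).
Proof.
(* At [k = n] the identity reads [n(n-1) = 2 S_n]. *)
move=> /(psum_compl (leqnn n)); rewrite subnn {1}/psum big_ord0.
by have := bin2_mul2 n; lia.
Qed.

Lemma strong_half (n : nat) (s : seq nat) :
  (forall i, i < n -> nth 0 s (n.-1 - i) + nth 0 s i = n.-1) ->
  (forall r, 0 < r -> r <= n./2 -> 'C(r, 2) < psum s r) ->
  strong n s.
Proof.
move=> compl half; apply/strongP => r r0 rn.
have [|rm] := leqP r n./2; first exact: half.
have := half (n - r) _ _; have := @psum_compl n s (n - r) (leq_subr _ _).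
rewrite subKn ?(ltnW rn) // (psum_total compl) => eqr lt_half.
have {}eqr : psum s r + (n - r) * n.-1 = 'C(n, 2) + psum s (n - r).
  by apply: eqr => i ilt; apply: compl; lia.
have {}lt_half : 'C(n - r, 2) < psum s (n - r) by apply: lt_half; lia.
(* Writing [n = r + k], with [r] and [k] successors, removes every truncated subtraction before
   [nia]. *)
have [k k0 nE] : exists2 k, 0 < k & n = r + k by exists (n - r); lia.
move: (bin2_mul2 n) (bin2_mul2 r) (bin2_mul2 (n - r)) eqr lt_half.
rewrite nE addKn; case: r r0 {rn rm nE} => // r _; case: k k0 => // k _ /=.
nia.
Qed.

(** * First halves and their mirror images *)

(** [strong m] stops at [r < m]; the last clause adds the strict inequality at [r = m], which lies
    inside the full sequence. The bound [c] will be [n.-1./2]. *)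
Definition is_half (m c : nat) (t : seq nat) : bool :=
  [&& size t == m, sorted leq t, strong m t, nth 0 t m.-1 <= c
    & 'C(m, 2) < psum t m].

(* The middle entry, present when n is odd, is (n-1)/2. *)
Definition mirror (n : nat) (t : seq nat) : seq nat :=
  mkseq (fun i => if i < n./2 then nth 0 t i
                  else if n.-1 - i < n./2 then n.-1 - nth 0 t (n.-1 - i)
                  else n.-1./2) n.

Lemma nth_mirror (n : nat) (t : seq nat) (i : nat) : i < n ->
  nth 0 (mirror n t) i =
    if i < n./2 then nth 0 t i
    else if n.-1 - i < n./2 then n.-1 - nth 0 t (n.-1 - i)
    else n.-1./2.
Proof. exact: nth_mkseq. Qed.

(** This bound keeps the subtraction in [mirror] from truncating and lets a half be coded by a tuple
    over ['I_c.+1]. Beyond the end, the default 0 satisfies it. *)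
Lemma half_entry_le (m c : nat) (t : seq nat) (i : nat) :
  is_half m c t -> nth 0 t i <= c.
Proof.
case/and5P=> /eqP sz srt _ last_le _.
have [im|?] := ltnP i m; last by rewrite nth_default ?sz.
apply: leq_trans last_le.
by apply: (sorted_leq_nth leq_trans leqnn) => //; rewrite ?inE; lia.
Qed.

Lemma take_mirror (n : nat) (t : seq nat) :
  size t = n./2 -> take n./2 (mirror n t) = t.
Proof.
move=> sz; apply: (@eq_from_nth _ 0) => [|i].
  by rewrite size_takel ?size_mkseq //; lia.
rewrite size_takel ?size_mkseq; last by lia.
by move=> im; rewrite nth_take // nth_mkseq ?im //; lia.
Qed.

Lemma mirror_SSCS (n : nat) (t : seq nat) :
  is_half n./2 n.-1./2 t -> is_SSCS n (mirror n t).
Proof.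
move=> ht; have le_c i := half_entry_le i ht.
case/and5P: ht => /eqP sz srt /strongP str _ str_m.
have nthE i (ilt : i < n) := nth_mirror t ilt.
have compl i : i < n ->
    nth 0 (mirror n t) (n.-1 - i) + nth 0 (mirror n t) i = n.-1.
  move=> ilt; rewrite !nthE; [|lia..]; rewrite subKn; last by lia.
  have := le_c i; have := le_c (n.-1 - i).
  by case: (ltnP i n./2); case: (ltnP (n.-1 - i) n./2); lia.
have half r : r <= n./2 -> psum (mirror n t) r = psum t r.
  by move=> rm; apply: eq_psum => i ir; rewrite nthE ?ifT //; lia.
have strg : strong n (mirror n t).
  apply: strong_half => // r r0 rm; rewrite half //.
  by have [/(str _ r0) //|mr] := ltnP r n./2; have -> : r = n./2 by lia.
apply/and3P; split=> //; last by apply/sccP => i im; apply: compl; lia.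
apply/and4P; split; first by rewrite size_mkseq.
- apply/(sortedP 0) => i; rewrite size_mkseq => ilt.
  rewrite !nthE //; last by lia.
  have le_t j k : j <= k -> k < n./2 -> nth 0 t j <= nth 0 t k.
    move=> jk km; apply: (sorted_leq_nth leq_trans leqnn) => //;
    by rewrite ?inE; lia.
  (* Monotonicity of [t], direct and reflected, settles steps within either half; the bounds by
     [n.-1./2] settle steps into and out of the middle. *)
  have := le_t i i.+1; have := le_t (n.-1 - i.+1) (n.-1 - i).
  have := le_c i; have := le_c (n.-1 - i.+1).
  case: (ltnP i n./2); case: (ltnP i.+1 n./2); case: (ltnP (n.-1 - i) n./2);
    case: (ltnP (n.-1 - i.+1) n./2); lia.
- apply/forallP => r; apply/implyP => r0; apply: ltnW.
  by apply: (strongP _ _ strg).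
- by rewrite (psum_total compl).
Qed.

Lemma SSCS_mirror (n : nat) (s : seq nat) :
  1 < n -> is_SSCS n s ->
  is_half n./2 n.-1./2 (take n./2 s) /\ s = mirror n (take n./2 s).
Proof.
move=> n1 /and3P[/and4P[/eqP sz srt _ /eqP total] /strongP str scc].
have compl := compl_all total scc.
have half r : r <= n./2 -> psum (take n./2 s) r = psum s r.
  by move=> rm; apply: eq_psum => i ir; rewrite nth_take //; lia.
split.
  apply/and5P; split; first by rewrite size_takel // sz; lia.
  - exact: take_sorted.
  - by apply/strongP => r r0 rm; rewrite half; [apply: str; lia|lia].
  - rewrite nth_take; last by lia.
    have := compl n./2.-1.
    have : nth 0 s n./2.-1 <= nth 0 s (n.-1 - n./2.-1).
      apply: (sorted_leq_nth leq_trans leqnn) => //; rewrite ?inE; lia.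
    lia.
  (* Since [1 < n], strength applies at [r = n./2], which is positive and less than [n]. *)
  - by rewrite half //; apply: str; lia.
apply: (@eq_from_nth _ 0) => [|i]; first by rewrite size_mkseq.
rewrite sz => ilt; rewrite nth_mkseq //; have := compl i ilt.
case: ltnP => im; first by rewrite nth_take.
case: ltnP => jm; first by rewrite nth_take //; lia.
(* Only the middle index is left; it is its own partner, so twice its entry is [n.-1]. *)
have -> : n.-1 - i = i by lia.
lia.
Qed.

Definition halves (m c : nat) : seq (seq nat) :=
  map (fun t : m.-tuple 'I_c.+1 => map val t)
    (enum [set t : m.-tuple 'I_c.+1 | is_half m c (map val t)]).

Lemma halves_uniq (m c : nat) : uniq (halves m c).
Proof.
rewrite map_inj_uniq ?enum_uniq // => t u.
by move/(inj_map val_inj)/val_inj.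
Qed.

Lemma mem_halves (m c : nat) : halves m c =i is_half m c.
Proof.
move=> t; apply/mapP/idP => [[u + ->]|ht]; first by rewrite mem_enum inE.
have sz : size (map (@inord c) t) == m.
  by rewrite size_map; case/and5P: ht.
have E : t = map val (Tuple sz).
  rewrite /= -map_comp -[LHS]map_id; apply/eq_in_map => x /(nthP 0)[i _ <-] /=.
  by rewrite inordK // ltnS (half_entry_le _ ht).
by exists (Tuple sz) => //; rewrite mem_enum inE -E.
Qed.

(** [mirror n] is a bijection from the halves onto the sequences counted, with inverse
    [take n./2]. *)
Lemma SSCS_halves (n : nat) :
  1 < n -> SSCS n = size (halves n./2 n.-1./2).
Proof.
move=> n1; rewrite -(size_map (mirror n)); apply: SSCS_size.
  rewrite map_inj_in_uniq ?halves_uniq // => t u.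
  rewrite !mem_halves => /and5P[/eqP st _ _ _ _] /and5P[/eqP su _ _ _ _] E.
  by rewrite -(take_mirror st) E take_mirror.
move=> s; apply/mapP/idP => [[t + ->]|].
  by rewrite mem_halves; apply: mirror_SSCS.
case/(SSCS_mirror n1) => ht E.
by exists (take n./2 s) => //; rewrite mem_halves.
Qed.

(** * Sorting the halves by sum and last entry *)

Lemma sum_nat_pred1 (a b x : nat) :
  \sum_(a <= i < b) (x == i) = (a <= x < b).
Proof.
have [xab|xab] := boolP (a <= x < b).
  rewrite (bigD1_seq x) ?iota_uniq ?mem_index_iota //= eqxx big1 // => i.
  by rewrite eq_sym => /negPf->.
rewrite big_nat_cond big1 // => i /andP[/andP[ai ib] _].
by apply/eqP; rewrite eqb0; apply: contraNneq xab => ->; rewrite ai.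
Qed.

(** The hypotheses on [T] and [E] make the last two clauses of [is_half] automatic once the sum is
    [T] and the last entry is [E]. The indicator form allows the sums to be exchanged. *)
Lemma G_halves (m c T E : nat) :
  'C(m, 2) < T -> E <= c ->
  G m T E = \sum_(t <- halves m c) (psum t m == T) * (nth 0 t m.-1 == E).
Proof.
move=> ltT leE; pose p t := (nth 0 t m.-1 == E) && (psum t m == T).
rewrite (@G_size m T E (filter p (halves m c))) ?filter_uniq ?halves_uniq //.
  rewrite -sum1_size big_filter big_mkcond.
  by apply: eq_bigr => t _; rewrite /p andbC; case: eqP; case: eqP.
move=> t; rewrite mem_filter mem_halves -!topredE /= /is_G /is_half /p.
case: (_ =P E) => [->|_]; case: (_ =P T) => [->|_]; rewrite ?andbF //.
by rewrite leE ltT.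
Qed.

Lemma SSCS_sum_G (n : nat) (m := n./2) (c := n.-1./2) : 1 < n ->
  SSCS n = \sum_('C(m, 2) + 1 <= T < (m * c).+1)
             \sum_(ceil_div T m <= E < c.+1) G m T E.
Proof.
move=> n1; have m0 : 0 < m by rewrite /m; lia.
rewrite SSCS_halves // -/m -/c.
transitivity (\sum_('C(m, 2) + 1 <= T < (m * c).+1)
    \sum_(ceil_div T m <= E < c.+1)
      \sum_(t <- halves m c) (psum t m == T) * (nth 0 t m.-1 == E)); last first.
  apply: eq_big_nat => T /andP[ltT _]; apply: eq_big_nat => E /andP[_ leE].
  by rewrite (@G_halves m c) //; lia.
(* With the sum over halves outermost, it remains to show that each half [t] contributes exactly
   1. *)
under eq_bigr => T _ do rewrite exchange_big /=.
rewrite exchange_big -sum1_size; apply: eq_big_seq => t.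
rewrite mem_halves => /and5P[/eqP sz srt _ last_le ltT].
have le_last := psum_le_last sz srt.
under eq_bigr => T _.
  rewrite -big_distrr /= sum_nat_pred1 ltnS last_le andbT ceil_div_le //.
  (* The lower limit on [E] has become [T <= m * nth 0 t m.-1], which monotonicity gives when [T] is
     the sum of [t]. *)
  rewrite (_ : (psum t m == T) * _ = (psum t m == T)); last first.
    by case: (psum t m =P T) => // <-; rewrite le_last.
  over.
(* The sum of [t] lies in the range of [T], being at most [m] times its last entry, hence at most
   [m * c]. *)
rewrite sum_nat_pred1 addn1 ltT ltnS /=.
by rewrite (leq_trans le_last) // leq_mul2l last_le orbT.
Qed.

Theorem theorem12 (m : nat) (hm : 0 < m) :
  SSCS (2 * m) =
    \sum_('C(m, 2) + 1 <= T < (m * (m - 1)).+1)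
      \sum_(ceil_div T m <= E < (m - 1).+1) G m T E
  /\
  SSCS (2 * m + 1) =
    \sum_('C(m, 2) + 1 <= T < (m ^ 2).+1)
      \sum_(ceil_div T m <= E < m.+1) G m T E.
Proof.
split; rewrite SSCS_sum_G; try lia.
  by have [-> ->] : (2 * m)./2 = m /\ (2 * m).-1./2 = m - 1 by lia.
have [-> ->] : (2 * m + 1)./2 = m /\ (2 * m + 1).-1./2 = m by lia.
by rewrite mulnn.
Qed.
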